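(* For $n\ge4$, the Artin group $A_{D_n}$ of type $D_n$ is locally indicable if and only if $n=4$.
   Context: $A_{D_n}$ ($n\ge4$) is the group with generators $a_1,\dots,a_n$ and relations $a_ia_j=a_ja_i$ for $1\le i<j\le n-1$, $|i-j|\ge2$; $a_na_j=a_ja_n$ for $j\ne n-2$; $a_ia_{i+1}a_i=a_{i+1}a_ia_{i+1}$ for $1\le i\le n-2$; $a_{n-2}a_na_{n-2}=a_na_{n-2}a_n$. A group $G$ is locally indicable if every nontrivial finitely generated subgroup $H$ of $G$ admits a nontrivial homomorphism $H\to\mathbb{Z}$. *)

(* Defs.v *)
From HB Require Import structures.
From mathcomp Require Import all_boot ssralg ssrint.
From mathcomp Require Import boolp classical_sets.

Set Implicit Arguments.
Unset Strict Implicit.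
Unset Printing Implicit Defensive.

Local Open Scope quotient_scope.
Local Open Scope group_scope.

(* The letter (x, false) is the generator x, and (x, true) is its inverse.    *)
Definition word (X : Type) : Type := seq (X * bool).

Definition gen {X : Type} (x : X) : word X := [:: (x, false)].

Definition flip_letter {X : Type} (l : X * bool) : X * bool := (l.1, ~~ l.2).

Definition word_inv {X : Type} (w : word X) : word X :=
  rev (map flip_letter w).

Section Presentation.
Variables (X : choiceType) (R : word X -> word X -> Prop).

Inductive pres_eq : word X -> word X -> Prop :=
| pres_eq_refl u : pres_eq u u
| pres_eq_sym u v : pres_eq u v -> pres_eq v u
| pres_eq_trans u v w : pres_eq u v -> pres_eq v w -> pres_eq u w
| pres_eq_cat u u' v v' :
    pres_eq u u' -> pres_eq v v' -> pres_eq (u ++ v) (u' ++ v')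
| pres_eq_cancel l : pres_eq [:: l; flip_letter l] [::]
| pres_eq_rel u v : R u v -> pres_eq u v.

Definition pres_eqb (u v : word X) : bool := `[< pres_eq u v >].

Lemma pres_eqb_refl : reflexive pres_eqb.
Proof. by move=> u; apply/asboolP; exact: pres_eq_refl. Qed.

Lemma pres_eqb_sym : symmetric pres_eqb.
Proof.
by move=> u v; apply/asboolP/asboolP => /pres_eq_sym.
Qed.

Lemma pres_eqb_trans : transitive pres_eqb.
Proof.
move=> v u w /asboolP uv /asboolP vw; apply/asboolP.
exact: pres_eq_trans uv vw.
Qed.

Canonical pres_equiv := EquivRel pres_eqb pres_eqb_refl pres_eqb_sym
  pres_eqb_trans.

Definition presented : Type := {eq_quot pres_equiv}.
HB.instance Definition _ := Choice.on presented.
HB.instance Definition _ := EqQuotient.on presented.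

Lemma flip_letterK : involutive (@flip_letter X).
Proof. by case=> x b; rewrite /flip_letter /= negbK. Qed.

Lemma word_inv_cat (u v : word X) :
  word_inv (u ++ v) = word_inv v ++ word_inv u.
Proof. by rewrite /word_inv map_cat rev_cat. Qed.

Lemma word_invK : involutive (@word_inv X).
Proof. by move=> u; rewrite /word_inv map_rev revK mapK //; exact: flip_letterK. Qed.

Lemma pres_eq_invr (u : word X) : pres_eq (u ++ word_inv u) [::].
Proof.
elim: u => [|l u IHu]; first exact: pres_eq_refl.
rewrite -cat1s word_inv_cat -catA [u ++ _]catA.
apply: pres_eq_trans (pres_eq_cancel l).
apply: (@pres_eq_cat [:: l] [:: l] _ [:: flip_letter l]).
  exact: pres_eq_refl.
apply: (@pres_eq_cat _ [::] _ [:: flip_letter l]) => //.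
exact: pres_eq_refl.
Qed.

Lemma pres_eq_invl (u : word X) : pres_eq (word_inv u ++ u) [::].
Proof. by rewrite -{2}[u]word_invK; exact: pres_eq_invr. Qed.

Lemma pres_eq_inv (u v : word X) :
  pres_eq u v -> pres_eq (word_inv u) (word_inv v).
Proof.
move=> uv; pose iu := word_inv u; pose iv := word_inv v.
have h1 : pres_eq (iu ++ (v ++ iv)) (iu ++ [::]).
  by apply: pres_eq_cat (pres_eq_refl _) (pres_eq_invr v).
have h2 : pres_eq (iu ++ (v ++ iv)) ([::] ++ iv).
  rewrite catA; apply: pres_eq_cat (pres_eq_refl _).
  apply: pres_eq_trans (pres_eq_invl u).
  by apply: pres_eq_cat (pres_eq_refl _) (pres_eq_sym uv).
rewrite cats0 in h1.
exact: pres_eq_trans (pres_eq_sym h1) h2.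
Qed.

Definition pres_one : presented := \pi_presented [::].
Definition pres_mul (g h : presented) : presented :=
  \pi_presented (repr g ++ repr h).
Definition pres_inv (g : presented) : presented :=
  \pi_presented (word_inv (repr g)).

Lemma pres_piP (u v : word X) :
  \pi_presented u = \pi_presented v <-> pres_eq u v.
Proof.
by split=> [/(eqmodP pres_equiv)/asboolP|/asboolP /(eqmodP pres_equiv)].
Qed.

Lemma pres_reprP (u : word X) : pres_eq (repr (\pi_presented u)) u.
Proof. by apply/pres_piP; rewrite reprK. Qed.

Lemma pres_mulE (u v : word X) :
  pres_mul (\pi_presented u) (\pi_presented v) = \pi_presented (u ++ v).
Proof. by apply/pres_piP; apply: pres_eq_cat; exact: pres_reprP. Qed.

Lemma pres_invE (u : word X) :
  pres_inv (\pi_presented u) = \pi_presented (word_inv u).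
Proof. by apply/pres_piP; apply: pres_eq_inv; exact: pres_reprP. Qed.

Lemma presW (P : presented -> Prop) :
  (forall u, P (\pi_presented u)) -> forall g, P g.
Proof. by move=> Ppi g; rewrite -[g]reprK. Qed.

Lemma pres_mulA : associative pres_mul.
Proof.
move=> g h k; move: g h k; apply: presW => u; apply: presW => v.
by apply: presW => w; rewrite !pres_mulE catA.
Qed.

Lemma pres_mul1 : left_id pres_one pres_mul.
Proof. by apply: presW => u; rewrite pres_mulE. Qed.

Lemma pres_mulr1 : right_id pres_one pres_mul.
Proof. by apply: presW => u; rewrite pres_mulE cats0. Qed.

Lemma pres_mulV : left_inverse pres_one pres_inv pres_mul.
Proof.
apply: presW => u; rewrite pres_invE pres_mulE; apply/pres_piP.
exact: pres_eq_invl.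
Qed.

Lemma pres_mulrV : right_inverse pres_one pres_inv pres_mul.
Proof.
apply: presW => u; rewrite pres_invE pres_mulE; apply/pres_piP.
exact: pres_eq_invr.
Qed.

HB.instance Definition _ := isGroup.Build presented
  pres_mulA pres_mul1 pres_mulr1 pres_mulV pres_mulrV.

End Presentation.

(* The ordinal i : 'I_n indexes the generator a_(i+1).                        *)
Definition lab (n : nat) (i : 'I_n) : nat := i.+1.

Inductive artinD_rel (n : nat) : word 'I_n -> word 'I_n -> Prop :=
| artinD_comm (i j : 'I_n) :
    lab i < lab j <= n - 1 -> 2 <= lab j - lab i ->
    artinD_rel (gen i ++ gen j) (gen j ++ gen i)
| artinD_comm_last (i j : 'I_n) :
    lab i = n -> lab j <> n - 2 ->
    artinD_rel (gen i ++ gen j) (gen j ++ gen i)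
| artinD_braid (i j : 'I_n) :
    lab i <= n - 2 -> lab j = lab i + 1 ->
    artinD_rel (gen i ++ gen j ++ gen i) (gen j ++ gen i ++ gen j)
| artinD_braid_last (i j : 'I_n) :
    lab i = n - 2 -> lab j = n ->
    artinD_rel (gen i ++ gen j ++ gen i) (gen j ++ gen i ++ gen j).

Definition artinD (n : nat) : groupType := presented (@artinD_rel n).

Definition subgroup (G : groupType) (H : set G) : Prop :=
  [/\ H 1, forall x y, H x -> H y -> H (x * y) & forall x, H x -> H x^-1].

Definition generated (G : groupType) (S : set G) : set G :=
  smallest (@subgroup G) S.

Definition finitely_generated (G : groupType) (H : set G) : Prop :=
  exists s : seq G, H = generated [set` s]%classic.

(* A homomorphism H -> Z is represented by a function on G whose values       *)
(* outside H are irrelevant.                                                  *)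
Definition locally_indicable (G : groupType) : Prop :=
  forall H : set G, subgroup H -> finitely_generated H ->
    H <> [set 1]%classic ->
    exists f : G -> int,
      (forall x y, H x -> H y -> f (x * y) = (f x + f y)%R) /\
      (exists2 x, H x & f x <> 0%R).

(* Main.v *)
(* Identifying the generators a_n and a_(n-1) maps A_{D_4} onto the braid group
   B_4, identifying two leaves again maps B_4 onto B_3, and B_3 maps onto Z.
   Each of these maps has a section and a free kernel, so A_{D_4} is an iterated
   extension of free groups.  Local indicability passes to extensions, and a
   free group is indicable by Magnus' expansion: on a nontrivial subgroup, a
   lowest-degree nonzero coefficient is additive.
   That the kernel of a map p : G -> Q with section s is free is seen through
   G -> F x| Q: G acts on the free group F by affine permutations, and the map
   th : F -> G is equivariant, th (g . z) = g (th z) s(p g)^-1, so g . 1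
   determines g in the kernel.
   For n >= 5, the Gorin-Lin relations produce in the subgroup B_5 of A_{D_n}
   a nontrivial finitely generated subgroup whose maps to Z are all trivial. *)
Require Import Defs.
From mathcomp Require Import all_boot order ssralg ssrnum ssrint zify.
From mathcomp Require Import boolp classical_sets.

Set Implicit Arguments.
Unset Strict Implicit.
Unset Printing Implicit Defensive.

Local Open Scope quotient_scope.
Local Open Scope group_scope.

Local Notation pi R w := (\pi_(presented R) w).

(** * Words, evaluation and presented groups *)

Section FreeReduction.
Variable X : choiceType.
Implicit Types (l : X * bool) (u v w : word X) (R : word X -> word X -> Prop).

Definition red_cons l w : word X :=
  if w is l' :: w' then if l' == flip_letter l then w' else l :: w
  else [:: l].

Definition red w : word X := foldr red_cons [::] w.

(** A computable test: equality in the free group, hence in every quotient of it. All explicit word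
    identities below are settled by evaluating it. *)
Definition feq u v : bool := red u == red v.

Definition reduced w : bool := sorted (fun l l' => l' != flip_letter l) w.

Lemma red_reduced w : reduced (red w).
Proof.
elim: w => //= l w; rewrite /red_cons; case: (red w) => //= l' w' IHw.
by case: eqP => [_|/eqP ll']; [exact: path_sorted IHw | rewrite /= ll'].
Qed.

Lemma pres_eq_red R w : pres_eq R w (red w).
Proof.
elim: w => [|l w IHw]; first exact: pres_eq_refl.
have h : pres_eq R (l :: w) (l :: red w).
  exact: (@pres_eq_cat _ _ [:: l] [:: l]) (pres_eq_refl _ _) IHw.
apply: pres_eq_trans h _; rewrite /= /red_cons; case: (red w) => [|l' w'].
  exact: pres_eq_refl.
case: eqP => [->|_]; last exact: pres_eq_refl.
exact: (@pres_eq_cat _ _ [:: l; _] [::])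
  (pres_eq_cancel _ _) (pres_eq_refl _ _).
Qed.

Lemma feq_pres R u v : feq u v -> pres_eq R u v.
Proof.
move=> /eqP uv; apply: pres_eq_trans (pres_eq_red R u) _; rewrite uv.
exact/pres_eq_sym/pres_eq_red.
Qed.

End FreeReduction.

Section Eval.
Variables (X : choiceType) (G : groupType) (e : X -> G).

Definition eval_letter (l : X * bool) : G :=
  if l.2 then (e l.1)^-1 else e l.1.

Definition eval (w : word X) : G := foldr (fun l g => eval_letter l * g) 1 w.

Lemma eval_cat u v : eval (u ++ v) = eval u * eval v.
Proof. by elim: u => [|l u /= ->]; rewrite ?mul1g ?mulgA. Qed.

Lemma eval_letter_flip l : eval_letter (flip_letter l) = (eval_letter l)^-1.
Proof. by case: l => x []; rewrite /eval_letter /= ?invgK. Qed.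

Lemma eval_inv w : eval (word_inv w) = (eval w)^-1.
Proof.
elim: w => [|l w IHw]; first by rewrite invg1.
rewrite -cat1s word_inv_cat eval_cat IHw /= mulg1 eval_letter_flip.
by rewrite invgM.
Qed.

Lemma eval_pres R u v : (forall u v, R u v -> eval u = eval v) ->
  pres_eq R u v -> eval u = eval v.
Proof.
move=> eR; elim=> //.
- by move=> {}u {}v w _ -> _ ->.
- by move=> {}u u' {}v v' _ euu' _ evv'; rewrite !eval_cat euu' evv'.
- by move=> l; rewrite /= mulg1 eval_letter_flip mulgV.
Qed.

(** Evaluates a chosen representative, so the definition makes sense before the relations are
    checked; [lift_pi] then shows independence of the choice. *)
Definition lift R (g : presented R) : G := eval (repr g).

Section Lift.
Variables (R : word X -> word X -> Prop).
Hypothesis eR : forall u v, R u v -> eval u = eval v.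

Lemma lift_pi w : lift (pi R w) = eval w.
Proof. exact: eval_pres (pres_reprP R w). Qed.

Lemma liftM : {morph @lift R : g h / g * h}.
Proof.
move=> g h; move: g h; apply: presW => u; apply: presW => v.
by rewrite [_ * _]pres_mulE !lift_pi eval_cat.
Qed.

End Lift.
End Eval.

Lemma eq_eval (X : choiceType) (G : groupType) (e e' : X -> G) :
  e =1 e' -> eval e =1 eval e'.
Proof. by move=> ee'; elim=> //= l w ->; rewrite /eval_letter ee'. Qed.

Lemma eval_morph (X : choiceType) (G H : groupType) (e : X -> G) (h : G -> H) :
  {morph h : x y / x * y} -> forall w, h (eval e w) = eval (h \o e) w.
Proof.
move=> hM; have h1 : h 1 = 1 by apply: (@mulgI _ (h 1)); rewrite -hM !mulg1.
have hV x : h x^-1 = (h x)^-1.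
  by apply: (@mulgI _ (h x)); rewrite -hM !mulgV.
elim=> //= l w IHw; rewrite hM IHw; congr (_ * _).
by rewrite /eval_letter; case: l.2; rewrite ?hV.
Qed.

Lemma piE (X : choiceType) (R : word X -> word X -> Prop) w :
  pi R w = eval (fun x => pi R (gen x)) w.
Proof.
elim: w => [//|l w IHw]; rewrite -cat1s -pres_mulE IHw /=; congr (_ * _).
case: l => x []; rewrite /eval_letter //=.
by rewrite [in RHS]/inv /= pres_invE.
Qed.

Definition subst (X Y : Type) (a : X -> word Y) (w : word X) : word Y :=
  flatten [seq if l.2 then word_inv (a l.1) else a l.1 | l <- w].

Lemma eval_subst (X Y : choiceType) (G : groupType) (e : Y -> G)
    (a : X -> word Y) w :
  eval e (subst a w) = eval (fun x => eval e (a x)) w.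
Proof.
elim: w => [//|l w IHw]; rewrite /subst /= eval_cat [eval e (flatten _)]IHw.
by congr (_ * _); rewrite /eval_letter; case: l.2; rewrite ?eval_inv.
Qed.

Lemma pi_subst (X Y : choiceType) (R : word Y -> word Y -> Prop)
    (a : X -> word Y) w :
  pi R (subst a w) = eval (fun x => pi R (a x)) w.
Proof. by rewrite piE eval_subst; apply: eq_eval => x; rewrite -piE. Qed.

Definition act (X T : Type) (e : X * bool -> T -> T) (w : word X) (t : T) : T :=
  foldr e t w.

Lemma act_cat (X T : Type) (e : X * bool -> T -> T) u v t :
  act e (u ++ v) t = act e u (act e v t).
Proof. exact: foldr_cat. Qed.

Lemma act_pres (X : choiceType) (T : Type) (e : X * bool -> T -> T)
    (R : word X -> word X -> Prop) u v :
  (forall l t, e l (e (flip_letter l) t) = t) ->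
  (forall u v t, R u v -> act e u t = act e v t) ->
  pres_eq R u v -> act e u =1 act e v.
Proof.
move=> eK eR; elim=> //.
- by move=> {}u {}v _ uv t; rewrite uv.
- by move=> {}u {}v w _ uv _ vw t; rewrite uv vw.
- by move=> {}u u' {}v v' _ uu' _ vv' t; rewrite !act_cat vv' uu'.
- by move=> {}u {}v uv t; exact: eR.
Qed.

(** * Indicability *)

(** Asking this of all nontrivial subgroups gives a property that passes through extensions. The set
    [N] lets kernels remain subsets of [G]. *)
Definition indicable_on (G : groupType) (N : set G) : Prop :=
  forall H : set G, subgroup H -> (H `<=` N)%classic -> H <> [set 1]%classic ->
    exists f : G -> int,
      (forall x y, H x -> H y -> f (x * y) = (f x + f y)%R) /\
      (exists2 x, H x & f x <> 0%R).

Lemma subgroup_nontrivial (G : groupType) (H : set G) :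
  subgroup H -> H <> [set 1]%classic -> exists2 x, H x & x <> 1.
Proof.
case=> H1 _ _ Hn1; apply: contrapT => nex; apply: Hn1; apply/seteqP.
split=> [x Hx|x -> //]; apply: contrapT => x1; apply: nex; by exists x.
Qed.

(** A map to [int] on the image of [H] is composed with [r]. Multiplicativity is asked only on [N]
    because the orbit map [g |-> g . 1] used later is multiplicative only on a kernel. *)
Lemma indicable_pullback (G F : groupType) (N : set G) (N' : set F)
    (r : G -> F) :
  (forall x y, N x -> N y -> r (x * y) = r x * r y) ->
  (forall x, N x -> N' (r x)) ->
  (forall x, N x -> r x = 1 -> x = 1) ->
  indicable_on N' -> indicable_on N.
Proof.
move=> rM rN r_inj indF H sH HN Hn1; have [H1 HM HV] := sH.
have r1 : r 1 = 1 by apply: (@mulgI _ (r 1)); rewrite -rM ?mulg1 //; exact: HN.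
have rV x : H x -> r x^-1 = (r x)^-1.
  move=> Hx; apply: (@mulgI _ (r x)); rewrite -rM ?mulgV //; apply: HN => //.
  exact: HV.
have [] := indF (r @` H)%classic.
- split; first by exists 1.
    by move=> _ _ [x Hx <-] [y Hy <-]; exists (x * y); [exact: HM|];
      rewrite rM //; exact: HN.
  by move=> _ [x Hx <-]; exists x^-1; [exact: HV | exact: rV].
- by move=> _ [x Hx <-]; apply: rN; exact: HN.
- have [x Hx x1] := subgroup_nontrivial sH Hn1.
  move=> rH; apply: x1; apply: r_inj; first exact: HN.
  have : (r @` H)%classic (r x) by exists x.
  by rewrite rH.
move=> f [fM [_ [x Hx <-] fx]]; exists (f \o r); split; last by exists x.
move=> y z Hy Hz /=; have [Ny Nz] := (HN _ Hy, HN _ Hz).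
by rewrite rM // fM.
Qed.

Lemma indicable_extension (G Q : groupType) (p : G -> Q) :
  {morph p : x y / x * y} ->
  indicable_on [set x | p x = 1]%classic -> indicable_on (@setT Q) ->
  indicable_on (@setT G).
Proof.
move=> pM indK indQ H sH _ Hn1; have [H1 HM HV] := sH.
have p1 : p 1 = 1 by apply: (@mulgI _ (p 1)); rewrite -pM !mulg1.
have pV x : p x^-1 = (p x)^-1.
  by apply: (@mulgI _ (p x)); rewrite -pM !mulgV.
(* Either [H] lies in the kernel, or its image in [Q] is nontrivial and a map to [int] is pulled
   back from there. *)
have [HK|/existsNP[x /not_implyP[Hx px]]] :=
  pselect (forall x, H x -> p x = 1); first exact: indK.
have [] := indQ (p @` H)%classic.
- split; first by exists 1.
    by move=> _ _ [y Hy <-] [z Hz <-]; exists (y * z); [exact: HM|].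
  by move=> _ [y Hy <-]; exists y^-1; [exact: HV | exact: pV].
- by [].
- move=> pH; apply: px; have : (p @` H)%classic (p x) by exists x.
  by rewrite pH.
move=> f [fM [_ [y Hy <-] fy]]; exists (f \o p); split; last by exists y.
by move=> y1 y2 Hy1 Hy2 /=; rewrite pM fM.
Qed.

Lemma locally_indicableW (G : groupType) :
  indicable_on (@setT G) -> locally_indicable G.
Proof. by move=> ind H sH _; exact: ind. Qed.

(** * Free groups are indicable *)

Definition free_rel (X : Type) (u v : word X) : Prop := False.

Definition free (X : choiceType) : groupType := presented (@free_rel X).

Section Magnus.
Import Order.TTheory GRing.Theory Num.Theory.
Variable X : choiceType.
Implicit Types (x y : X) (l : X * bool) (w : word X) (m : seq X).
Implicit Types f g : seq X -> int.

Local Open Scope ring_scope.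

(* A power series in non-commuting variables is the function giving the
   coefficient of each monomial; [mul_1X x] and [div_1X x] are the left
   multiplications by 1 + x and by its inverse. *)
Definition mul_1X x f m : int :=
  f m + (if m is y :: m' then if y == x then f m' else 0 else 0).

Fixpoint div_1X x f m : int :=
  f m - (if m is y :: m' then if y == x then div_1X x f m' else 0 else 0).

Definition magnus_letter l f : seq X -> int :=
  if l.2 then div_1X l.1 f else mul_1X l.1 f.

Definition series1 m : int := (m == [::])%:R.

Definition magnus w : seq X -> int := act magnus_letter w series1.

Lemma magnus_letterK l f :
  magnus_letter l (magnus_letter (flip_letter l) f) = f.
Proof.
apply/funext; case: l => x []; rewrite /magnus_letter /=.
  elim=> [|y m IHm] /=; first by rewrite /mul_1X addr0 subr0.
  by rewrite IHm /mul_1X addrK.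
by case=> [|y m]; rewrite /mul_1X /= ?subr0 ?addr0 // subrK.
Qed.

Lemma magnus_pres u v : pres_eq (@free_rel X) u v -> magnus u = magnus v.
Proof. by move=> uv; apply: (act_pres magnus_letterK _ uv). Qed.

(** The product of series: the sum of [f m1 * g m2] over all splittings [m = m1 ++ m2], computed by
    moving the first letter of [m] into [f]. *)
Fixpoint conv f g m : int :=
  f [::] * g m +
  (if m is y :: m' then conv (fun n => f (y :: n)) g m' else 0).

Lemma convD f1 f2 g m :
  conv (fun n => f1 n + f2 n) g m = conv f1 g m + conv f2 g m.
Proof.
elim: m f1 f2 => [|y m IHm] f1 f2 /=; first by rewrite !addr0 mulrDl.
by rewrite mulrDl IHm addrACA.
Qed.

Lemma conv0 g m : conv (fun=> 0) g m = 0.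
Proof. by elim: m => [|y m /= ->]; rewrite /= mul0r addr0. Qed.

Lemma conv1 g : conv series1 g = g.
Proof.
apply/funext => -[|y m] /=; rewrite mul1r ?addr0 //.
by rewrite conv0 addr0.
Qed.

Lemma conv_mul_1X x f g : conv (mul_1X x f) g = mul_1X x (conv f g).
Proof.
apply/funext => -[|y m]; rewrite /mul_1X /= !addr0 // -addrA; congr (_ + _).
rewrite (convD (fun n => f (y :: n)) (fun n => if y == x then f n else 0)).
by case: ifP => // _; rewrite conv0.
Qed.

Lemma conv_magnus_letter l f g :
  conv (magnus_letter l f) g = magnus_letter l (conv f g).
Proof.
case: l => x []; last exact: conv_mul_1X.
(* Division by 1 + x reduces to multiplication by writing [f] as (1 + x) [h]. *)
set h := magnus_letter (x, true) f.
rewrite -[in RHS](magnus_letterK (x, false) f).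
rewrite -[magnus_letter (flip_letter _) f]/h.
by rewrite [in RHS](conv_mul_1X x h) (magnus_letterK (x, true)).
Qed.

Lemma magnus_cat u v : magnus (u ++ v) = conv (magnus u) (magnus v).
Proof.
elim: u => [|l u IHu]; first by rewrite conv1.
by rewrite [LHS]/= -/(magnus _) IHu -conv_magnus_letter.
Qed.

Lemma magnus_nil w : magnus w [::] = 1.
Proof.
elim: w => //= l w; rewrite -/(magnus _) /magnus_letter.
by case: l => x [] /=; rewrite /mul_1X /= ?subr0 ?addr0.
Qed.

Lemma conv_low f g m : (forall n, size n < size m -> f n = 0)%N ->
  conv f g m = f m * g [::].
Proof.
elim: m f => [|y m IHm] f f0 /=; first by rewrite addr0.
by rewrite f0 // mul0r add0r IHm // => n nm; exact: f0.
Qed.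

(** Only the two splittings of [m] with an empty factor survive. This is the additivity of
    lowest-degree coefficients. *)
Lemma conv_lowest f g m : f [::] = 1 -> g [::] = 1 -> m <> [::] ->
  (forall n, n <> [::] -> size n < size m -> f n = 0)%N ->
  conv f g m = f m + g m.
Proof.
case: m => // y m f1 g1 _ f0; rewrite /= f1 mul1r addrC conv_low ?g1 ?mulr1 //.
by move=> n nm; exact: f0.
Qed.

Definition alternating m : bool := sorted (fun x y => x != y) m.

(** The inverse of 1 + x is 1 - x + x^2 - ..., and the terms from x^2 on contribute only to
    monomials starting with x x, which are not alternating. *)
Lemma magnus_letter_alt l f y m : alternating (y :: m) ->
  magnus_letter l f (y :: m) =
  f (y :: m) + (if y == l.1 then (-1) ^+ l.2 * f m else 0).
Proof.
case: l => x [] alt; rewrite /magnus_letter /=.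
  case: eqP => [yx|_]; rewrite ?subr0 ?addr0 //.
  rewrite mulN1r; case: m alt => [|z m] /=; first by rewrite subr0.
  by rewrite -yx => /andP[yz _]; rewrite eq_sym (negPf yz) subr0.
by rewrite /mul_1X /=; case: eqP; rewrite ?mul1r.
Qed.

(* For a reduced word x1^e1 ... xr^er, the series is described on alternating
   monomials: [x :: b] is x1 ... xr, [e] is e1 and [p] is e2 ... er. *)
Lemma magnus_reduced l w : reduced (l :: w) ->
  exists (b : seq X) (e p : int),
  [/\ alternating (l.1 :: b), 0 < e * (-1) ^+ l.2 & p != 0] /\
  [/\ magnus (l :: w) (l.1 :: b) = e * p, magnus (l :: w) b = p &
   (forall m, alternating m -> size b < size m ->
      (size b).+1 < size m \/ head l.1 m != l.1 ->
      magnus (l :: w) m = 0)%N].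
Proof.
elim: w l => [|l' w IHw] l red_lw.
  exists [::], ((-1) ^+ l.2), 1; split; first by rewrite -expr2 sqrr_sign.
  split.
  - by rewrite /= magnus_letter_alt //= eqxx /series1 /= add0r.
  - by rewrite magnus_nil.
  case=> [|y m] //= alt _; rewrite magnus_letter_alt // /series1 /= add0r.
  case=> [|/negPf -> //]; case: m {alt} => // z m _.
  by rewrite mulr0 if_same.
have /andP[ll' red_w] : (l' != flip_letter l) && reduced (l' :: w) by [].
have {IHw}[b [e [p [[alt e0 p0] [fxb fb f0]]]]] := IHw _ red_w.
have -> : magnus [:: l, l' & w] = magnus_letter l (magnus (l' :: w)) by [].
move: (magnus (l' :: w)) fxb fb f0 => f fxb fb f0.
(* If the generator repeats, reducedness forces equal signs, so the first exponent grows in absolute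
   value. Otherwise [l] opens a new syllable, and [e * p] becomes the new [p]. *)
have [xx'|xx'] := eqVneq l.1 l'.1.
  have bb' : l.2 = l'.2.
    apply/eqP; move: ll'; rewrite /flip_letter; case: (l) (l') xx' => x b1.
    by case=> x' b2 /= ->; rewrite xpair_eqE eqxx; case: b1; case: b2.
  exists b, (e + (-1) ^+ l.2), p; rewrite xx' bb' mulrDl -expr2 sqrr_sign.
  split; first by split=> //; rewrite addr_gt0.
  split.
  - by rewrite magnus_letter_alt // xx' eqxx fxb fb bb' mulrDl.
  - case: b alt fb {fxb f0} => [|y b]; first by rewrite /magnus_letter;
      case: l.2; rewrite /= /mul_1X /= ?addr0 ?subr0.
    move=> /= /andP[x'y alt] fb; rewrite magnus_letter_alt // xx'.
    by rewrite eq_sym (negPf x'y) addr0.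
  case=> [|y m] //= alt_m bm hm.
  rewrite magnus_letter_alt // xx' f0 //= add0r; case: eqP => // yx'.
  rewrite f0 ?mulr0 //; first exact: path_sorted alt_m.
    by case: hm => //; rewrite yx' eqxx.
  case: m alt_m {bm} hm => [|z m]; first by rewrite yx' eqxx => _ [].
  by rewrite /= yx' => /andP[x'z _] _; right; rewrite eq_sym.
exists (l'.1 :: b), ((-1) ^+ l.2), (e * p); split.
  split; first by rewrite /alternating /= xx'.
    by rewrite -expr2 sqrr_sign.
  by rewrite mulf_neq0 //; apply: contraTneq e0 => ->; rewrite mul0r ltxx.
have xb0 : f (l.1 :: l'.1 :: b) = 0.
  by apply: f0 => //=; [rewrite xx' | left].
split.
- by rewrite magnus_letter_alt /= ?xx' // eqxx xb0 add0r fxb.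
- by rewrite magnus_letter_alt // eq_sym (negPf xx') addr0.
case=> [|y m] //= alt_m bm hm; rewrite magnus_letter_alt //.
rewrite f0 //=; [|exact: ltnW|by left].
rewrite add0r; case: eqP => // yx; rewrite f0 ?mulr0 //.
  exact: path_sorted alt_m.
by left; case: hm => //; rewrite yx eqxx.
Qed.

Lemma magnus_faithful w : magnus w = series1 -> pres_eq (@free_rel X) w [::].
Proof.
move=> w1; suff r0 : red w = [::] by rewrite -r0; exact: pres_eq_red.
have := red_reduced w; have := magnus_pres (pres_eq_red _ w).
rewrite w1; case: (red w) => // l r r1.
move=> /magnus_reduced [b [e [p [[_ e0 p0] [fxb _ _]]]]].
move: fxb; rewrite -r1 /series1 => /esym/eqP; rewrite mulf_eq0 (negPf p0) orbF.
by move=> /eqP e1; move: e0; rewrite e1 mul0r ltxx.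
Qed.

Theorem free_indicable : indicable_on (@setT (free X)).
Proof.
move=> H sH _ Hn1; pose M (g : free X) := magnus (repr g).
have MM (x y : free X) : M (x * y)%g = conv (M x) (M y).
  by rewrite /M -magnus_cat; apply/magnus_pres/pres_reprP.
pose P k := `[< exists (g : free X) m,
  [/\ H g, m <> [::], size m = k & M g m <> 0] >].
have exP : exists k, P k.
  have [g Hg g1] := subgroup_nontrivial sH Hn1; apply: contrapT => nP.
  apply: g1; rewrite -[g]reprK; apply/pres_piP/magnus_faithful/funext => m.
  have [->|/eqP m0] := eqVneq m [::]; first by rewrite magnus_nil.
  rewrite /series1 (introF eqP m0); apply: contrapT => gm; apply: nP.
  by exists (size m); apply/asboolP; exists g, m.
(* The degree of [m] is least over all of [H], so [conv_lowest] applies at [m] to every product in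
   [H]. *)
case: (ex_minnP exP) => k /asboolP[g [m [Hg m0 mk gm]]] k_min.
exists (fun h => M h m); split; last by exists g.
move=> x y Hx Hy; rewrite MM conv_lowest //; try exact: magnus_nil.
move=> n n0 nm.
apply: contrapT => xn; suff : (k <= size n)%N by rewrite leqNgt -mk nm.
by apply: k_min; apply/asboolP; exists x, n.
Qed.

End Magnus.

(** * Artin groups and split extensions by free groups *)

Definition alt_word (X : Type) (cm : rel X) (i j : X) : word X :=
  if cm i j then gen i ++ gen j else gen i ++ gen j ++ gen i.

Inductive artin_rel (X : Type) (cm : rel X) : word X -> word X -> Prop :=
| ArtinRel i j : artin_rel cm (alt_word cm i j) (alt_word cm j i).

Definition artin (X : choiceType) (cm : rel X) : groupType :=
  presented (artin_rel cm).

Section Certificate.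
Variables (X : choiceType) (cm : rel X).

Definition relator_step (s : word X * X * X) (w : word X) : word X :=
  let: (p, i, j) := s in
  p ++ alt_word cm i j ++ word_inv (alt_word cm j i) ++ word_inv p ++ w.

(* The certificate lists conjugators p_k and relators r_k such that u is freely
   equal to the product of the p_k r_k p_k^-1, followed by v. *)
Lemma artin_certificate (s : seq (word X * X * X)) u v :
  feq u (foldr relator_step v s) -> pres_eq (artin_rel cm) u v.
Proof.
move=> /feq_pres us; apply: pres_eq_trans (us _) _ => {us}.
elim: s => [|[[p i] j] s IHs]; first exact: pres_eq_refl.
apply/pres_piP; rewrite -(proj2 (pres_piP _ _ _) IHs) /= -!pres_mulE -pres_invE.
have -> : pi (artin_rel cm) (alt_word cm i j) = pi _ (alt_word cm j i).
  exact/pres_piP/pres_eq_rel/ArtinRel.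
rewrite -!pres_invE (pres_mulA _ (pres_inv _)) pres_mulrV pres_mul1.
by rewrite !pres_mulA pres_mulrV pres_mul1.
Qed.

End Certificate.

Definition map_gen (X Y : Type) (f : X -> Y) (w : word X) : word Y :=
  [seq (f l.1, l.2) | l <- w].

Lemma pres_map_gen (X Y : choiceType) (R : word X -> word X -> Prop)
    (R' : word Y -> word Y -> Prop) (f : X -> Y) u v :
  (forall u v, R u v -> pres_eq R' (map_gen f u) (map_gen f v)) ->
  pres_eq R u v -> pres_eq R' (map_gen f u) (map_gen f v).
Proof.
move=> fR; elim=> {u v}.
- by move=> u; exact: pres_eq_refl.
- by move=> u v _ /pres_eq_sym.
- by move=> u v w _ uv _; exact: pres_eq_trans.
- move=> u u' v v' _ uu' _ vv'; rewrite /map_gen !map_cat.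
  exact: pres_eq_cat.
- by move=> l; exact: pres_eq_cancel.
- exact: fR.
Qed.

Section SplitExtension.
Variables (X Y Z : choiceType) (cmX : rel X) (cmY : rel Y).
Variables (f : X -> Y) (s : Y -> X) (a : Y * bool -> Z -> word Z).
Variables (c : X -> word Z) (th : Z -> word X).

Local Notation RX := (artin_rel cmX).
Local Notation RY := (artin_rel cmY).
Local Notation RF := (@free_rel Z).
Local Notation G := (artin cmX).
Local Notation Q := (artin cmY).
Local Notation F := (free Z).

Definition act_word (w : word Y) (z : word Z) : word Z :=
  act (fun l => subst (a l)) w z.

(** The inverse of the affine map z |-> c a(z) is z |-> a^-1(c^-1) a^-1(z), which dictates the
    translation of an inverse letter. *)
Definition cocycle_letter (l : X * bool) : word Z :=
  if l.2 then subst (a (f l.1, true)) (word_inv (c l.1)) else c l.1.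

Definition affine_word (w : word X) (z : word Z) : word Z :=
  act (fun l z => cocycle_letter l ++ subst (a (f l.1, l.2)) z) w z.

Hypothesis f_rel : forall i j,
  pres_eq RY (map_gen f (alt_word cmX i j)) (map_gen f (alt_word cmX j i)).
Hypothesis s_rel : forall i j,
  pres_eq RX (map_gen s (alt_word cmY i j))
             (map_gen s (alt_word cmY j i)).
Hypothesis aK : forall l k, feq (subst (a l) (a (flip_letter l) k)) (gen k).
Hypothesis a_rel : forall i j k,
  feq (act_word (alt_word cmY i j) (gen k))
      (act_word (alt_word cmY j i) (gen k)).
Hypothesis c_rel : forall i j,
  feq (affine_word (alt_word cmX i j) [::])
      (affine_word (alt_word cmX j i) [::]).
Hypothesis th_a : forall y k, pres_eq RX (subst th (a (y, false) k))
  (gen (s y) ++ th k ++ word_inv (gen (s y))).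
Hypothesis th_c : forall x,
  feq (subst th (c x)) (gen x ++ word_inv (gen (s (f x)))).

Let piF (w : word Z) : F := pi RF w.
Let aF l : F -> F := lift (fun k => piF (a l k)) (R := RF).
Let actF (w : word Y) (z : F) : F := act aF w z.
Let affF (w : word X) (z : F) : F :=
  act (fun l z => piF (cocycle_letter l) * aF (f l.1, l.2) z) w z.

Let aF_pi l w : aF l (piF w) = piF (subst (a l) w).
Proof. by rewrite /piF /aF lift_pi // pi_subst. Qed.

Let aFM l : {morph aF l : x y / x * y}.
Proof. exact: liftM. Qed.

Let actFM w : {morph actF w : x y / x * y}.
Proof.
move=> x y; elim: w => //= l w; rewrite /actF /= => ->.
exact: aFM.
Qed.

Let actF_pi w z : actF w (piF z) = piF (act_word w z).
Proof. by elim: w => //= l w; rewrite /actF /= => ->; exact: aF_pi. Qed.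

Let affF_pi w z : affF w (piF z) = piF (affine_word w z).
Proof.
elim: w => //= l w; rewrite /affF /= => ->; rewrite aF_pi.
exact: pres_mulE.
Qed.

(** The linear part of the affine action factors through [f]. It is therefore trivial on the kernel,
    where w . z = (w . 1) z. *)
Let affF_split w z : affF w z = affF w 1 * actF (map_gen f w) z.
Proof.
elim: w => [|l w IHw] /=; first by rewrite mul1g.
by rewrite /affF /= -!/(affF _ _) IHw aFM mulgA.
Qed.

Let morphF_ext (K : groupType) (g h : F -> K) :
  {morph g : x y / x * y} -> {morph h : x y / x * y} ->
  (forall k, g (piF (gen k)) = h (piF (gen k))) -> g =1 h.
Proof.
move=> gM hM gh z; rewrite -[z]reprK piE !eval_morph //.
by apply: eq_eval => k; exact: gh.
Qed.

Let aFK l z : aF l (aF (flip_letter l) z) = z.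
Proof.
have hM : {morph aF l \o aF (flip_letter l) : x y / x * y}.
  by move=> x y /=; rewrite !aFM.
apply: (morphF_ext hM (h := id)) => // k /=.
rewrite !aF_pi; apply/pres_piP/feq_pres.
rewrite /subst /= cats0; exact: aK.
Qed.

Let actF_pres u v : pres_eq RY u v -> actF u =1 actF v.
Proof.
apply: act_pres => [|_ _ z [i j]]; first exact: aFK.
apply: (morphF_ext (actFM _) (actFM _)) => k; rewrite !actF_pi.
exact/pres_piP/feq_pres.
Qed.

Let f_pres u v : pres_eq RX u v -> pres_eq RY (map_gen f u) (map_gen f v).
Proof. by apply: pres_map_gen => _ _ [i j]. Qed.

Let s_pres u v : pres_eq RY u v -> pres_eq RX (map_gen s u) (map_gen s v).
Proof. by apply: pres_map_gen => _ _ [i j]. Qed.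

Let affF_pres u v : pres_eq RX u v -> affF u =1 affF v.
Proof.
apply: act_pres => [[x b] z|u' v' z uv].
  have cV : piF (cocycle_letter (x, true)) = aF (f x, true) (piF (c x))^-1.
    by rewrite [(piF _)^-1]pres_invE aF_pi.
  case: b; rewrite /flip_letter /= cV -?aFM.
    by rewrite mulKg (aFK (_, true)).
  by rewrite (aFK (_, false)) mulVKg.
(* The linear parts of the two sides agree through [f], so a relation need only be compared at the
   point 1. *)
rewrite -/(affF u' z) -/(affF v' z) (affF_split u') (affF_split v').
congr (_ * _); last exact/actF_pres/f_pres/pres_eq_rel.
by case: uv => i j; rewrite !(affF_pi _ [::]); exact/pres_piP/feq_pres.
Qed.

Let thF : F -> G := lift (fun k => pi RX (th k)) (R := RF).

Let thF_pi w : thF (piF w) = pi RX (subst th w).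
Proof. by rewrite /piF /thF lift_pi // pi_subst. Qed.

Let thFM : {morph thF : x y / x * y}.
Proof. exact: liftM. Qed.

Let thF_aF y z : thF (aF (y, false) z) =
  pi RX (gen (s y)) * thF z * (pi RX (gen (s y)))^-1.
Proof.
move: z; apply: morphF_ext => [||k].
- by move=> z z'; rewrite /= aFM thFM.
- by move=> z z'; rewrite thFM !mulgA mulgVK.
rewrite aF_pi !thF_pi /subst /= !cats0 -/(subst th _).
rewrite [_^-1]pres_invE -mulgA [pi _ (th k) * _]pres_mulE [_ * _]pres_mulE.
exact/pres_piP.
Qed.

(** For a generator this combines [th_c] and [th_a]; an inverse letter x^-1 is handled by the case
    of x at the point x^-1 . z0. *)
Let thF_affF w z : thF (affF w z) =
  pi RX w * thF z * (pi RX (map_gen s (map_gen f w)))^-1.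
Proof.
have pos x z0 : thF (affF (gen x) z0) =
    pi RX (gen x) * thF z0 * (pi RX (gen (s (f x))))^-1.
  rewrite /affF /= thFM thF_aF thF_pi.
  have -> : pi RX (subst th (c x)) = pi RX (gen x) * (pi RX (gen (s (f x))))^-1.
    rewrite [_^-1]pres_invE [_ * _]pres_mulE.
    exact/pres_piP/feq_pres.
  by rewrite !mulgA mulgVK.
have piV x : pi RX [:: (x, true)] = (pi RX (gen x))^-1.
  by rewrite [RHS]pres_invE.
elim: w => [|[x b] w IHw].
  by rewrite [pi _ _]/(1 : G) mul1g invg1 mulg1.
set z0 := affF w z in IHw.
have -> : thF (affF ((x, b) :: w) z) =
    pi RX [:: (x, b)] * thF z0 * (pi RX [:: (s (f x), b)])^-1.
  case: b; last exact: pos.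
  have := pos x (affF [:: (x, true)] z0).
  have -> : affF (gen x) (affF [:: (x, true)] z0) = z0.
    rewrite /affF -act_cat.
    exact: (affF_pres (pres_eq_cancel _ (x, false)) z0).
  by move=> ->; rewrite !piV mulgA mulKg invgK mulgVK.
rewrite IHw -[(x, b) :: w]cat1s -[in RHS]pres_mulE /map_gen !map_cat -pres_mulE.
by rewrite [in RHS]invgM !mulgA.
Qed.

Theorem split_extension_indicable :
  indicable_on (@setT Q) -> indicable_on (@setT G).
Proof.
pose p (g : G) : Q := pi RY (map_gen f (repr g)).
have fE (g h : G) : pres_eq RX (repr (g * h)) (repr g ++ repr h).
  exact: pres_reprP.
have pM : {morph p : g h / g * h}.
  move=> g h; rewrite /p [RHS]pres_mulE -map_cat; apply/pres_piP.
  exact: f_pres.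
apply: (indicable_extension pM).
have pker g : p g = 1 -> pres_eq RY (map_gen f (repr g)) [::].
  by move=> g1; apply/pres_piP.
apply: (@indicable_pullback G F _ setT (fun g : G => affF (repr g) 1)) => //;
  last exact: free_indicable.
  move=> g h /pker g1 _; rewrite (affF_pres (fE g h)) /affF act_cat.
  by rewrite -!/(affF _ _) affF_split (actF_pres g1).
(* Equivariance at 1: if g . 1 = 1 and p g = 1, then 1 = g s(p g)^-1 = g. *)
move=> g /pker g1 rg1; have := thF_affF (repr g) 1.
rewrite rg1 reprK (proj2 (pres_piP _ _ _) (s_pres g1)).
have -> : thF 1 = 1 by apply: (thF_pi [::]).
by rewrite [pi _ _]/(1 : G) invg1 !mulg1 => <-.
Qed.

End SplitExtension.

Lemma pres_mono (X : choiceType) (R R' : word X -> word X -> Prop) :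
  (forall u v, R u v -> pres_eq R' u v) ->
  forall u v, pres_eq R u v -> pres_eq R' u v.
Proof.
have mapid (w : word X) : map_gen id w = w.
  by elim: w => [|[x b] w /= ->].
move=> RR' u v uv; rewrite -[u]mapid -[v]mapid.
by apply: pres_map_gen uv => {}u {}v; rewrite !mapid; exact: RR'.
Qed.

Lemma indicable_same (X : choiceType) (R R' : word X -> word X -> Prop) :
  (forall u v, R u v -> pres_eq R' u v) ->
  (forall u v, R' u v -> pres_eq R u v) ->
  indicable_on (@setT (presented R')) -> indicable_on (@setT (presented R)).
Proof.
move=> /pres_mono RR' /pres_mono R'R.
apply: (indicable_pullback (r := fun g : presented R => pi R' (repr g))) => //.
  move=> g h _ _; rewrite [RHS]pres_mulE; apply/pres_piP/RR'.
  exact: pres_reprP.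
move=> g _ /pres_piP g1; rewrite -[g]reprK; apply/pres_piP; exact: R'R.
Qed.

(** * Star-shaped Artin groups *)

(** Reducing modulo [n.+1] makes every literal an index, so that tables of numerals can be
    evaluated. *)
Definition ordn n (k : nat) : 'I_n.+1 := Ordinal (ltn_pmod k (ltn0Sn n)).

Definition all_ord n (P : pred 'I_n.+1) : bool :=
  all (fun k => P (ordn n k)) (iota 0 n.+1).

Lemma all_ordP n (P : pred 'I_n.+1) : all_ord P -> forall i, P i.
Proof.
move=> /allP allP i.
have -> : i = ordn n i by apply/val_inj; rewrite /= modn_small.
by apply: (allP (val i)); rewrite mem_iota /= add0n.
Qed.

Definition all_ord2 m n (P : 'I_m.+1 -> 'I_n.+1 -> bool) : bool :=
  all_ord (fun i => all_ord (P i)).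

Lemma all_ord2P m n (P : 'I_m.+1 -> 'I_n.+1 -> bool) :
  all_ord2 P -> forall i j, P i j.
Proof.
move=> allP i.
exact: all_ordP (all_ordP (P := fun i => all_ord (P i)) allP i).
Qed.

(* The integers k and - k, for k > 0, encode the letters a_k and a_k^-1. *)
Definition word_of n (s : seq int) : word 'I_n.+1 :=
  [seq if z is Posz k then (ordn n k.-1, false) else (ordn n (absz z).-1, true)
  | z <- s].

Definition certificate := seq (seq int * int * int).

Definition decode n (t : certificate) :
    seq (word 'I_n.+1 * 'I_n.+1 * 'I_n.+1) :=
  [seq (word_of n s.1.1, ordn n (absz s.1.2).-1, ordn n (absz s.2).-1)
  | s <- t].

(* The Artin group of the star whose centre is the second generator. *)
Definition star n : rel 'I_n := fun i j => (val i == 1%N) == (val j == 1%N).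

(* The tables f and s list the images of the generators under the projection
   and its section; row i of ap (resp. an) lists the images of the free
   generators under a_(i+1) (resp. its inverse), c lists the translation parts
   of the affine action, and th the values of the free generators in the group.
   The certificates show that th is equivariant. *)
Section StarExtension.
Variables x y z : nat.
Variables (f s : seq nat) (ap an : seq (seq (seq int))) (c th : seq (seq int)).
Variable certs : seq (seq certificate).

Definition gen_table m n (t : seq nat) (i : 'I_m.+1) : 'I_n.+1 :=
  ordn n (nth 0 t i).-1.

Definition word_table m n (t : seq (seq int)) (i : 'I_m.+1) : word 'I_n.+1 :=
  word_of n (nth [::] t i).

Definition action_table (l : 'I_y.+1 * bool) : 'I_z.+1 -> word 'I_z.+1 :=
  word_table z (nth [::] (if l.2 then an else ap) l.1).

(** The certificate is a single relator with empty conjugator: a relation should become the one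
    between [g i] and [g j], or a free identity. *)
Definition preserves_star m n (g : 'I_m.+1 -> 'I_n.+1) : bool :=
  all_ord2 (fun i j =>
    feq (map_gen g (alt_word (@star _) i j))
      (relator_step (@star _) ([::], g i, g j)
        (map_gen g (alt_word (@star _) j i)))).

Lemma preserves_starP m n (g : 'I_m.+1 -> 'I_n.+1) : preserves_star g ->
  forall i j, pres_eq (artin_rel (@star _)) (map_gen g (alt_word (@star _) i j))
                (map_gen g (alt_word (@star _) j i)).
Proof.
move=> gS i j; apply: (@artin_certificate _ _ [:: ([::], g i, g j)]).
by rewrite /=; exact: (all_ord2P gS).
Qed.

Definition star_extension_check : bool :=
  [&& preserves_star (@gen_table x y f), preserves_star (@gen_table y x s),
    all_ord2 (fun i k => all (fun b =>
      feq (subst (action_table (i, b)) (action_table (i, ~~ b) k)) (gen k))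
      [:: true; false]),
    all_ord2 (fun i j => all_ord (fun k =>
      feq (act_word action_table (alt_word (@star _) i j) (gen k))
          (act_word action_table (alt_word (@star _) j i) (gen k)))),
    all_ord2 (fun i j =>
      feq (affine_word (@gen_table x y f) action_table (word_table z c)
             (alt_word (@star _) i j) [::])
          (affine_word (@gen_table x y f) action_table (word_table z c)
             (alt_word (@star _) j i) [::])),
    all_ord2 (fun i k =>
      feq (subst (@word_table z x th) (action_table (i, false) k))
        (foldr (relator_step (@star _))
          (gen (gen_table x s i) ++ @word_table z x th k ++
             word_inv (gen (gen_table x s i)))
          (decode x (nth [::] (nth [::] certs i) k))))
  & all_ord (fun i =>
      feq (subst (@word_table z x th) (word_table z c i))
        (gen i ++ word_inv (gen (gen_table x s (@gen_table x y f i)))))].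

Lemma star_extension_indicable : star_extension_check ->
  indicable_on (@setT (artin (@star y.+1))) ->
  indicable_on (@setT (artin (@star x.+1))).
Proof.
case/and5P=> f_rel s_rel aK a_rel /and3P[c_rel th_a th_c].
apply: (@split_extension_indicable _ _ 'I_z.+1 _ _ (gen_table y f)
  (gen_table x s) action_table (word_table z c) (word_table x th)).
- exact: preserves_starP.
- exact: preserves_starP.
- by move=> [i b] k; have /and3P[] := all_ord2P aK i k; case: b.
- by move=> i j; apply: all_ordP; exact: (all_ord2P a_rel i j).
- exact: (all_ord2P c_rel).
- by move=> i k; apply: artin_certificate; exact: (all_ord2P th_a i k).
- exact: (all_ordP th_c).
Qed.

End StarExtension.

Section StarGroups.
Local Open Scope int_scope.

Lemma star1_indicable : indicable_on (@setT (artin (@star 1))).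
Proof.
apply: (indicable_same _ _ (@free_indicable 'I_1)) => [_ _ [i j]|//].
by rewrite (ord1 i) (ord1 j); exact: pres_eq_refl.
Qed.

(* The kernel of B_3 -> Z is free on u = a_1 a_2^-1 and v = a_2 u a_2^-1. *)
Lemma star2_indicable : indicable_on (@setT (artin (@star 2))).
Proof.
(* The section picks a_2, which conjugates u to v and v to u^-1 v; a_1 = u a_2 has translation u. *)
apply: (@star_extension_indicable 1%N 0%N 1%N [:: 1; 1]%N [:: 2]%N
  [:: [:: [:: 2]; [:: -1; 2]]] [:: [:: [:: 1; -2]; [:: 1]]]
  [:: [:: 1]; [::]] [:: [:: 1; -2]; [:: 2; 1; -2; -2]]
  [:: [:: [::];
        [:: ([:: 2; -1], 2, 1)]]]).
  by vm_compute.
exact: star1_indicable.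
Qed.

(* The kernel of the map B_4 -> B_3 identifying a_3 with a_1 is free on
   t = a_3 a_1^-1 and a_2 t a_2^-1. *)
Lemma star3_indicable : indicable_on (@setT (artin (@star 3))).
Proof.
(* The section values a_1 and a_2 have empty translation, and a_3 = t a_1 has translation t. *)
apply: (@star_extension_indicable 2%N 1%N 1%N [:: 1; 2; 1]%N [:: 1; 2]%N
  [:: [:: [:: 1]; [:: -1; 2]]; [:: [:: 2]; [:: 2; -1; 2]]]
  [:: [:: [:: 1]; [:: 1; 2]]; [:: [:: 1; -2; 1]; [:: 1]]]
  [:: [::]; [::]; [:: 1]] [:: [:: 3; -1]; [:: 2; 3; -1; -2]]
  [:: [:: [:: ([::], 3, 1)];
        [:: ([:: 1; -3], 2, 3);
         ([:: 1; 2; 3; -2; -1; -2], 1, 2)]];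
     [:: [::];
        [:: ([:: 2; 3; -1; -2], 1, 2);
         ([:: 2], 3, 2);
         ([:: 2; 2; 3; 2; -3; -1], 3, 1);
         ([:: 2; 2; 3; 2; -1; -3; -2; -3], 2, 3);
         ([:: 2; 2; 3; 2; -1; -2; -1], 2, 1)]]]).
  by vm_compute.
exact: star2_indicable.
Qed.

(* The kernel of the map A_{D_4} -> B_4 identifying a_4 with a_3 is free on
   t = a_4 a_3^-1, a_2 t a_2^-1 and a_1 a_2 t a_2^-1 a_1^-1. *)
Lemma star4_indicable : indicable_on (@setT (artin (@star 4))).
Proof.
(* Here a_4 = t a_3 alone has a nonempty translation. *)
apply: (@star_extension_indicable 3%N 2%N 2%N [:: 1; 2; 3; 3]%N [:: 1; 2; 3]%N
  [:: [:: [:: 1]; [:: 3]; [:: 3; -2; 3]]; [:: [:: 2]; [:: 2; -1; 2]; [:: 3]];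
      [:: [:: 1]; [:: -1; 2]; [:: -1; 3]]]
  [:: [:: [:: 1]; [:: 2; -3; 2]; [:: 2]]; [:: [:: 1; -2; 1]; [:: 1]; [:: 3]];
      [:: [:: 1]; [:: 1; 2]; [:: 1; 3]]]
  [:: [::]; [::]; [::]; [:: 1]]
  [:: [:: 4; -3]; [:: 2; 4; -3; -2]; [:: 1; 2; 4; -3; -2; -1]]
  [:: [:: [:: ([::], 4, 1);
         ([:: 1; 4; -1; -3], 1, 3)];
        [::];
        [:: ([:: 1; 2; 4; -3; -2; -1; 2; 3; -4; -2; 1; 2], 4, 1);
         ([:: 1; 2; 4; -3; -2; -1; 2; 3; -4; -2; 1; 2; 1; 4; -3; -1], 1, 3);
         ([:: 1; 2; 4; -3; -2; -1; 2; 3; -4; -2; 1; 2; 1; 4; -3; -2; -1; -2], 2, 1);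
         ([:: 1; 2; 4; -3; -2; -1; 2; 3; -4; -2], 1, 2);
         ([:: 1; 2; 4; -3; -2; -1; 2], 3, 1);
         ([:: 1; 2; 4; -3; -2; -1; 2; 1; 3; -4; -1], 1, 4);
         ([:: 1; 2], 4, 1);
         ([:: 1; 2; 1; 4; -3; -1], 1, 3);
         ([:: 1; 2; 1; 4; -3; -2; -1; -2], 2, 1);
         ([::], 1, 2);
         ([:: 2; 1; 2; 4; -3; -2], 3, 2);
         ([:: 2; 1; 2], 4, 2);
         ([:: 2; 1; 2; 2; 4; 2; -4; -3], 4, 3);
         ([:: 2; 1; 2; 2; 4; 2; -3; -4; -2; -4], 2, 4);
         ([:: 2; 1; 2; 2; 4; 2; -3; -2; -3], 2, 3);
         ([:: 2; 1; 2; 2; 4; -3; -2; -1; -2; -1], 1, 2);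
         ([::], 2, 1);
         ([:: 1; 2; 1; 2; 4; -3; -1; -2; -1], 1, 2);
         ([:: 1], 2, 1);
         ([:: 1; 1; 2; 1; 4; -1; -3], 3, 1);
         ([:: 1; 1; 2], 1, 4)]];
     [:: [::];
        [:: ([:: 2; 4; -3; -2], 3, 2);
         ([:: 2], 4, 2);
         ([:: 2; 2; 4; 2; -4; -3], 4, 3);
         ([:: 2; 2; 4; 2; -3; -4; -2; -4], 2, 4);
         ([:: 2; 2; 4; 2; -3; -2; -3], 2, 3)];
        [:: ([:: 1; 2; 4; -3; -2; -1], 2, 1);
         ([:: 1; 2; 4; -3], 1, 3);
         ([::], 1, 2);
         ([:: 2; 1; 2; -1], 4, 1)]];
     [:: [:: ([::], 4, 3)];
        [:: ([:: 3; -4], 2, 4);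
         ([:: 3; 2; 4; -2; -3; -2], 3, 2)];
        [:: ([:: 3; -4; 1], 2, 4);
         ([:: 3; -4], 1, 4);
         ([:: 3; 1; 2; 4; -2; -3; -2; -1], 3, 1);
         ([:: 3; 1; 2; 4; -2; -3; -2], 3, 2)]]]).
  by vm_compute.
exact: star3_indicable.
Qed.

End StarGroups.

(** * The Artin groups of type D *)

(** For n = 4 the node a_(n-2) is a_2, joined to a_1, a_3 and a_4: the centre of the star. *)
Lemma artinD4_indicable : indicable_on (@setT (artinD 4)).
Proof.
apply: (indicable_same (R' := artin_rel (@star 4))) star4_indicable.
  have relE (i j : 'I_4) : pres_eq (artin_rel (@star 4))
      (alt_word (@star 4) i j) (alt_word (@star 4) j i).
    exact/pres_eq_rel/ArtinRel.
  move=> _ _ [] i j; move: (relE i j); rewrite /alt_word /star;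
    by case: i j => [[|[|[|[|?]]]] ?] [[|[|[|[|?]]]] ?].
move=> _ _ [[i ilt] [j jlt]].
move: i j ilt jlt => [|[|[|[|i]]]] [|[|[|[|j]]]] // ilt jlt;
  rewrite /alt_word /=;
  by [ rewrite (bool_irrelevance ilt jlt); exact: pres_eq_refl
     | exact/pres_eq_rel/artinD_comm | exact/pres_eq_rel/artinD_comm_last
     | exact/pres_eq_rel/artinD_braid | exact/pres_eq_rel/artinD_braid_last
     | exact/pres_eq_sym/pres_eq_rel/artinD_comm
     | exact/pres_eq_sym/pres_eq_rel/artinD_comm_last
     | exact/pres_eq_sym/pres_eq_rel/artinD_braid
     | exact/pres_eq_sym/pres_eq_rel/artinD_braid_last ].
Qed.

(** * Failure of local indicability for n >= 5 *)

Definition swap (k x : nat) : nat :=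
  if x == k then k.+1 else if x == k.+1 then k else x.

Lemma swapK k : involutive (swap k).
Proof. by move=> x; rewrite /swap; repeat case: eqP; lia. Qed.

(** The case [k = m] serves the commuting generators a_(n-1) and a_n, which act by the same
    transposition. *)
Lemma swap_comm k m x : k = m \/ k.+1 < m \/ m.+1 < k ->
  swap k (swap m x) = swap m (swap k x).
Proof. by move=> km; rewrite /swap; repeat case: eqP; lia. Qed.

Lemma swap_braid k x :
  swap k (swap k.+1 (swap k x)) = swap k.+1 (swap k (swap k.+1 x)).
Proof. by rewrite /swap; repeat case: eqP; lia. Qed.

(* The permutation action through the symmetric group, with a_n acting like
   a_(n-1). *)
Definition perm_letter n (l : 'I_n * bool) : nat -> nat :=
  swap (if lab l.1 == n then n - 2 else l.1 : nat).

Lemma perm_pres n u v : 4 <= n ->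
  pres_eq (@artinD_rel n) u v ->
  act (@perm_letter n) u =1 act (@perm_letter n) v.
Proof.
move=> n4; apply: act_pres => [l x|_ _ x []]; first exact: swapK.
- move=> i j ij ji; rewrite /perm_letter /lab /=; apply: swap_comm.
  by move: ij ji; rewrite /lab; repeat case: eqP; lia.
- move=> i j ij ji; rewrite /perm_letter /=; apply: swap_comm.
  by move: ij ji (ltn_ord j); rewrite /lab; repeat case: eqP; lia.
- move=> i j ij ji; rewrite /perm_letter /=.
  have -> : (lab i == n) = false by move: ij; rewrite /lab; lia.
  have -> : (if lab j == n then n - 2 else j : nat) = i.+1.
    move: ij ji; rewrite /lab. case: eqP; lia.
  exact: swap_braid.
- move=> i j ij ji; rewrite /perm_letter /= ji eqxx.
  have -> : (lab i == n) = false by move: ij; rewrite /lab; lia.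
  have -> : n - 2 = i.+1 by move: ij; rewrite /lab /=; lia.
  exact: swap_braid.
Qed.

Definition braid n : rel 'I_n := fun i j =>
  [|| i == j, i + 1 < j | j + 1 < i].

(** For n >= 5 the generators a_1, ..., a_4 avoid a_n and form a chain, which gives a homomorphism
    from B_5. *)
Lemma braid_artinD n (n4 : 4 <= n) u v : 5 <= n ->
  pres_eq (artin_rel (@braid 4)) u v ->
  pres_eq (@artinD_rel n) (map_gen (widen_ord n4) u) (map_gen (widen_ord n4) v).
Proof.
move=> n_gt4; apply: pres_map_gen => _ _ [i j].
suff lt_ij (x y : 'I_4) : x < y -> pres_eq (@artinD_rel n)
    (map_gen (widen_ord n4) (alt_word (@braid 4) x y))
    (map_gen (widen_ord n4) (alt_word (@braid 4) y x)).
  case: (ltngtP i j) => [/lt_ij //|/lt_ij/pres_eq_sym //|/val_inj ->].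
  exact: pres_eq_refl.
move=> xy; have y4 := ltn_ord y.
rewrite /alt_word /braid eq_sym; case: eqP => [yx|_] /=.
  by move: xy; rewrite yx ltnn.
have -> : (y + 1 < x) = false by lia.
rewrite orbF; case: ltnP => xy1.
  by apply/pres_eq_rel/artinD_comm; rewrite /lab /=; lia.
by apply/pres_eq_rel/artinD_braid; rewrite /lab /=; lia.
Qed.

Section GorinLin.
Local Open Scope int_scope.

(* The Gorin-Lin relations in the commutator subgroup of B_5, between
   u = a_2 a_1^-1, v = a_1 a_2 a_1^-2, w = a_2 a_3 a_1^-1 a_2^-1,
   q = a_3 a_1^-1 and r = a_4 a_1^-1. *)
Lemma gorin_lin_relations
    (u := word_of 3 [:: 2; -1]) (v := word_of 3 [:: 1; 2; -1; -1])
    (w := word_of 3 [:: 2; 3; -1; -2]) (q := word_of 3 [:: 3; -1])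
    (r := word_of 3 [:: 4; -1]) :
  let eqB := pres_eq (artin_rel (@braid 4)) in
  [/\ eqB (u ++ q ++ word_inv u) w,
      eqB (v ++ q ++ word_inv v) (word_inv q ++ w),
      eqB (u ++ r) (r ++ v),
      eqB (v ++ r) (r ++ word_inv u ++ v) &
      eqB (q ++ r ++ q) (r ++ q ++ r)].
Proof.
split.
- apply: (@artin_certificate _ _ (decode 3 [:: ([:: 2; 3; -1; -3], 3, 1)])).
  by vm_compute.
- apply: (@artin_certificate _ _ (decode 3
    [:: ([:: 1; 2; -1; -1; 3; 1; -3; -1], 3, 1); ([:: 1; 2; 3; -1; -3], 3, 1);
        ([:: 1; 2; 3; -2; -1; -2], 2, 1); ([:: 1; 2; 3; -2; -3; -2], 3, 2)])).
  by vm_compute.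
- apply: (@artin_certificate _ _ (decode 3
    [:: ([:: 2; -1], 4, 1); ([::], 2, 4)])).
  by vm_compute.
- apply: (@artin_certificate _ _ (decode 3
    [:: ([:: 1; 2; -1; 4; -1; -4], 4, 1); ([:: 1; 2; -1], 4, 1); ([:: 1], 2, 4);
        ([:: 1; 4; -1; -4], 1, 4); ([:: 4; 1; 2; -1; -2; -1], 2, 1)])).
  by vm_compute.
- apply: (@artin_certificate _ _ (decode 3
    [:: ([:: 3; 4; -1; -4], 4, 1); ([:: 3; 4; -1; -1; 3; 1; -3; -1], 3, 1);
        ([:: 3; 4; 3; -1; -3], 3, 1); ([::], 3, 4); ([:: 4; 3; -1], 1, 4);
        ([:: 4; 3; -1; 4; -1; -4], 1, 4); ([:: 4; 3; -1; -3], 1, 3)])).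
  by vm_compute.
Qed.

End GorinLin.

Lemma generated_subgroup (G : groupType) (S : set G) : subgroup (generated S).
Proof.
split=> [H [[]] //|x y Hx Hy H HS|x Hx H HS].
  by case: (HS) => -[_ HM _] _; apply: HM; [exact: Hx | exact: Hy].
by case: (HS) => -[_ _ HV] _; apply: HV; exact: Hx.
Qed.

Lemma generated_additive0 (G : groupType) (S : set G) (f : G -> int) :
  (forall x y, generated S x -> generated S y -> f (x * y) = (f x + f y)%R) ->
  (forall x, S x -> f x = 0%R) -> forall x, generated S x -> f x = 0%R.
Proof.
move=> fM fS; have [S1 SM SV] := generated_subgroup S.
have f1 : f 1 = 0%R by have := fM 1 1 S1 S1; rewrite mulg1; lia.
pose K : set G := fun x => generated S x /\ f x = 0%R.
suff KS : (generated S `<=` K)%classic by move=> x /KS[].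
apply: smallest_sub => [|x Sx]; last first.
  by split; [exact: sub_gen_smallest | exact: fS].
split; first by split.
  by move=> x y [Sx fx] [Sy fy]; split; [exact: SM | rewrite fM // fx fy].
move=> x [Sx fx]; split; first exact: SV.
by have := fM x x^-1 Sx (SV _ Sx); rewrite mulgV f1 fx; lia.
Qed.

Lemma artinD_not_locally_indicable n : 5 <= n -> ~ locally_indicable (artinD n).
Proof.
move=> n5 ind; have n4 := ltnW n5.
pose P (w : word 'I_4) : artinD n := pi _ (map_gen (widen_ord n4) w).
have PM u v : P (u ++ v) = P u * P v.
  by rewrite [RHS]pres_mulE -map_cat.
have PV u : P (word_inv u) = (P u)^-1.
  rewrite [RHS]pres_invE /P /word_inv /map_gen map_rev -!map_comp.
  by [].
have PE u v : pres_eq (artin_rel (@braid 4)) u v -> P u = P v.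
  by move=> uv; apply/pres_piP/braid_artinD.
have [] := gorin_lin_relations.
set u := word_of 3 [:: 2; -1]%Z; set v := word_of 3 [:: 1; 2; -1; -1]%Z.
set w := word_of 3 [:: 2; 3; -1; -2]%Z; set q := word_of 3 [:: 3; -1]%Z.
set r := word_of 3 [:: 4; -1]%Z.
move=> /PE e1 /PE e2 /PE e3 /PE e4 /PE e5; rewrite !PM !PV in e1 e2 e3 e4 e5.
pose gens := [:: P u; P v; P w; P q; P r].
pose H := generated [set` gens]%classic.
have sH : subgroup H := generated_subgroup _.
have [H1 HM HV] := sH.
have [|| f [fM [x Hx]]] := ind H sH; first by exists gens.
  have Hu : H (P u) by apply: sub_gen_smallest; rewrite /= inE eqxx.
  (* The permutation of a_2 a_1^-1 sends 0 to 2, so [P u] is nontrivial. *)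
  move=> H1E; move: Hu; rewrite H1E => /pres_piP /(perm_pres n4)/(_ 0%N).
  rewrite /act /= /perm_letter /lab /= !modn_small //.
  by rewrite (ltn_eqF (ltnW (ltnW n4))) (ltn_eqF (ltnW n4)).
apply; apply: (generated_additive0 fM) Hx => {x}.
have f1 : f 1 = 0%R by have := fM 1 1 H1 H1; rewrite mulg1; lia.
have fV x : H x -> f x^-1 = (- f x)%R.
  by move=> Hx; have := fM x x^-1 Hx (HV _ Hx); rewrite mulgV f1; lia.
have Hg x : x \in gens -> H x by move=> xg; exact: sub_gen_smallest.
have [Hu Hv Hw Hq Hr] : [/\ H (P u), H (P v), H (P w), H (P q) & H (P r)].
  by split; apply: Hg; rewrite !inE eqxx ?orbT.
(* Additively, [e1] and [e2] give f q = f w = 2 f q, so both vanish; [e5] gives f r = f q, [e3]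
   gives f u = f v, and [e4] gives f u = 0. *)
have {}e1 := congr1 f e1; have {}e2 := congr1 f e2; have {}e3 := congr1 f e3.
have {}e4 := congr1 f e4; have {}e5 := congr1 f e5.
rewrite !(fM, fV) in e1 e2 e3 e4 e5; auto.
move=> x; rewrite /= !inE.
by do 4?[case/orP]; move=> /eqP ->; lia.
Qed.

Theorem theorem4p10 (n : nat) (hn : 4 <= n) :
  locally_indicable (artinD n) <-> n = 4.
Proof.
split=> [ind|->]; last exact/locally_indicableW/artinD4_indicable.
apply/eqP; rewrite eqn_leq hn andbT leqNgt; apply/negP => n5.
exact: artinD_not_locally_indicable ind.
Qed.
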